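(* Let $(\Sigma,\mathscr R)$ be a Dedukti theory with $\hookrightarrow_{\beta\mathscr R}$ confluent and $\mathscr R$ arity-preserving. (1) If $\|A\|$ is defined, then for every term $N$, $\|A\{N/x\}\|$ is defined and $\|A\|=\|A\{N/x\}\|$. (2) If $A\hookrightarrow_{\beta\mathscr R}A'$ and $\|A\|$ is defined, then $\|A'\|$ is defined and $\|A\|=\|A'\|$. (3) If $A\equiv A'$ and both $\|A\|$ and $\|A'\|$ are defined, then $\|A\|=\|A'\|$.
   Context: Dedukti terms $x\mid c[\vec M]\mid\mathtt{TYPE}\mid\mathtt{KIND}\mid MN\mid\lambda x:A.M\mid\Pi x:A.B$ with constants of fixed arity declared in $\Sigma$ as $c[\Delta]:A$; rewrite rules $c[\vec l]\hookrightarrow r$; $\hookrightarrow_{\beta\mathscr R}$ is $\beta$ together with the closure of $\mathscr R$ under contexts and substitutions, and $\equiv$ is the equivalence it generates. A constant is type-level (written $\alpha$) if its declared type is of the form $\Pi\vec x:\vec B.\mathtt{TYPE}$; a rule is type-level if its head constant is. $\mathscr R$ is arity-preserving if every type-level rule has right-hand side in $R::=\alpha[\vec M]\mid R\,N\mid\lambda x:A.R$. The partial map $\|-\|$ into simple types $\sigma::=*\mid\sigma\to\sigma$: $\|\mathtt{TYPE}\|=*$, $\|\alpha[\vec M]\|=*$ for type-level $\alpha$, $\|\Pi x:A.B\|=\|A\|\to\|B\|$, $\|A\,N\|=\|A\|$, $\|\lambda x:A.B\|=\|B\|$, undefined on all other terms. *)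

(* Defs.v *)
From mathcomp Require Import all_boot.
From Stdlib Require Import Relations.

Set Implicit Arguments.
Unset Strict Implicit.
Unset Printing Implicit Defensive.

(* Terms are in de Bruijn form: [Var n] is the n-th enclosing binder or, beyond
   those, a free variable; [Lam A M] and [Prod A B] bind index 0 in their second
   argument only.  A constant carries exactly [ar c] arguments. *)
Inductive term (C : Type) (ar : C -> nat) : Type :=
| Var of nat
| Con (c : C) of {ffun 'I_(ar c) -> term ar}
| TYPE
| KIND
| App of term ar & term ar
| Lam of term ar & term ar
| Prod of term ar & term ar.
Arguments Var {C ar}.
Arguments Con {C ar}.
Arguments TYPE {C ar}.
Arguments KIND {C ar}.

Section Substitution.
Variables (C : Type) (ar : C -> nat).
Local Notation term := (term ar).

Definition upr (f : nat -> nat) (n : nat) : nat :=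
  if n is m.+1 then (f m).+1 else 0.

Fixpoint rename (f : nat -> nat) (t : term) : term :=
  match t with
  | Var n => Var (f n)
  | Con c args => Con c [ffun i => rename f (args i)]
  | TYPE => TYPE
  | KIND => KIND
  | App M N => App (rename f M) (rename f N)
  | Lam A M => Lam (rename f A) (rename (upr f) M)
  | Prod A B => Prod (rename f A) (rename (upr f) B)
  end.

Definition up (s : nat -> term) (n : nat) : term :=
  if n is m.+1 then rename succn (s m) else Var 0.

(* Simultaneous capture-avoiding substitution. *)
Fixpoint inst (s : nat -> term) (t : term) : term :=
  match t with
  | Var n => s n
  | Con c args => Con c [ffun i => inst s (args i)]
  | TYPE => TYPE
  | KIND => KIND
  | App M N => App (inst s M) (inst s N)
  | Lam A M => Lam (inst s A) (inst (up s) M)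
  | Prod A B => Prod (inst s A) (inst (up s) B)
  end.

(* A{N/x}: the free variable x is replaced by N, all others are kept. *)
Definition subst (A : term) (x : nat) (N : term) : term :=
  inst (fun y => if y == x then N else Var y) A.

(* M{N/x} for the body M of a binder of x: index 0 is replaced by N, and the
   remaining indices are lowered since the binder disappears.  Lemma
   [subst_bodyE] relates it to [subst]. *)
Definition subst_body (M N : term) : term :=
  inst (fun y => if y is z.+1 then Var z else N) M.

Section TermInd.
Variable P : term -> Prop.
Hypothesis PVar : forall n, P (Var n).
Hypothesis PCon : forall c (args : {ffun 'I_(ar c) -> term}),
  (forall i, P (args i)) -> P (Con c args).
Hypothesis PTYPE : P TYPE.
Hypothesis PKIND : P KIND.
Hypothesis PApp : forall M N, P M -> P N -> P (App M N).
Hypothesis PLam : forall A M, P A -> P M -> P (Lam A M).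
Hypothesis PProd : forall A B, P A -> P B -> P (Prod A B).

Fixpoint term_nested_ind (t : term) : P t :=
  match t with
  | Var n => PVar n
  | Con c args => PCon (fun i => term_nested_ind (args i))
  | TYPE => PTYPE
  | KIND => PKIND
  | App M N => PApp (term_nested_ind M) (term_nested_ind N)
  | Lam A M => PLam (term_nested_ind A) (term_nested_ind M)
  | Prod A B => PProd (term_nested_ind A) (term_nested_ind B)
  end.
End TermInd.

Lemma rename_rename f g h t : (forall n, g (f n) = h n) ->
  rename g (rename f t) = rename h t.
Proof.
elim/term_nested_ind: t f g h => //=.
- by move=> n f g h H; rewrite H.
- move=> c args IH f g h H; congr Con; apply/ffunP=> i.
  by rewrite !ffunE; apply: IH.
- by move=> M N IM IN f g h H; rewrite (IM _ _ h) // (IN _ _ h).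
- move=> A M IA IM f g h H; rewrite (IA _ _ h) // (IM _ _ (upr h)) //.
  by case=> //= n; rewrite H.
- move=> A M IA IM f g h H; rewrite (IA _ _ h) // (IM _ _ (upr h)) //.
  by case=> //= n; rewrite H.
Qed.

Lemma rename_inst f s s' t : (forall n, rename f (s n) = s' n) ->
  rename f (inst s t) = inst s' t.
Proof.
have upP f1 s1 s2 : (forall n, rename f1 (s1 n) = s2 n) ->
    forall n, rename (upr f1) (up s1 n) = up s2 n.
  move=> H [//|n] /=; rewrite -H (rename_rename (h := succn \o f1)) //.
  by rewrite (rename_rename (h := succn \o f1)).
elim/term_nested_ind: t f s s' => //=.
- move=> c args IH f s s' H; congr Con; apply/ffunP=> i.
  by rewrite !ffunE; apply: IH.
- by move=> M N IM IN f s s' H; rewrite (IM _ _ s') // (IN _ _ s').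
- by move=> A M IA IM f s s' H; rewrite (IA _ _ s') // (IM _ _ (up s')) //; apply: upP.
- by move=> A M IA IM f s s' H; rewrite (IA _ _ s') // (IM _ _ (up s')) //; apply: upP.
Qed.

Lemma rename_id f t : f =1 id -> rename f t = t.
Proof.
have uprP f1 : f1 =1 id -> upr f1 =1 id by move=> H [|n] //=; rewrite H.
elim/term_nested_ind: t f => //=.
- by move=> n f H; rewrite H.
- by move=> c args IH f H; congr Con; apply/ffunP=> i; rewrite ffunE IH.
- by move=> M N IM IN f H; rewrite IM // IN.
- by move=> A M IA IM f H; rewrite IA // IM //; apply: uprP.
- by move=> A M IA IM f H; rewrite IA // IM //; apply: uprP.
Qed.

Lemma subst_bodyE M N :
  subst_body M N = rename predn (subst M 0 (rename succn N)).
Proof.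
symmetry; apply: rename_inst => -[|n] //=.
by rewrite (rename_rename (h := id)) // rename_id.
Qed.

End Substitution.

Record rule (C : Type) (ar : C -> nat) := Rule {
  rule_head : C;
  rule_args : {ffun 'I_(ar rule_head) -> term ar};
  rule_rhs : term ar
}.

(* The declaration of c is c[Delta] : A with Delta = [decl_ctx c], whose length
   is the arity of c, and A = [decl_type c].  In the i-th entry of Delta the
   previous i variables are in scope, and in A all of them. *)
Record theory := Theory {
  const : Type;
  arity : const -> nat;
  decl_ctx : forall c : const, (arity c).-tuple (term arity);
  decl_type : const -> term arity;
  rules : rule arity -> Prop
}.

Section Theory.
Variable T : theory.
Local Notation term := (term (@arity T)).

Inductive step : term -> term -> Prop :=
| step_beta A M N : step (App (Lam A M) N) (subst_body M N)
| step_rule (r : rule (@arity T)) (s : nat -> term) :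
    rules r ->
    step (inst s (Con (rule_head r) (rule_args r))) (inst s (rule_rhs r))
| step_con c (args args' : {ffun 'I_(arity c) -> term}) i :
    step (args i) (args' i) -> (forall j, j != i -> args j = args' j) ->
    step (Con c args) (Con c args')
| step_appl M M' N : step M M' -> step (App M N) (App M' N)
| step_appr M N N' : step N N' -> step (App M N) (App M N')
| step_laml A A' M : step A A' -> step (Lam A M) (Lam A' M)
| step_lamr A M M' : step M M' -> step (Lam A M) (Lam A M')
| step_prodl A A' B : step A A' -> step (Prod A B) (Prod A' B)
| step_prodr A B B' : step B B' -> step (Prod A B) (Prod A B').

Definition steps : term -> term -> Prop := clos_refl_trans term step.

Definition conv : term -> term -> Prop := clos_refl_sym_trans term step.

Definition confluent : Prop :=
  forall M N P : term, steps M N -> steps M P ->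
  exists Q, steps N Q /\ steps P Q.

Fixpoint ends_in_TYPE (A : term) : bool :=
  match A with
  | TYPE => true
  | Prod _ B => ends_in_TYPE B
  | _ => false
  end.

Lemma ends_in_TYPEP A :
  reflect (exists Bs : seq term, A = foldr (@Prod _ _) TYPE Bs) (ends_in_TYPE A).
Proof.
apply: (iffP idP) => [|[Bs ->]]; last by elim: Bs.
elim: A => //= [_|B _ A IH /IH[Bs ->]]; first by exists [::].
by exists (B :: Bs).
Qed.

Definition type_level (c : const T) : bool := ends_in_TYPE (decl_type c).

Inductive type_level_rhs : term -> Prop :=
| tlr_con c args : type_level c -> type_level_rhs (Con c args)
| tlr_app M N : type_level_rhs M -> type_level_rhs (App M N)
| tlr_lam A M : type_level_rhs M -> type_level_rhs (Lam A M).

Definition arity_preserving : Prop :=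
  forall r : rule (@arity T),
  rules r -> type_level (rule_head r) -> type_level_rhs (rule_rhs r).

End Theory.

Inductive simple_type : Type :=
| Star
| Arrow of simple_type & simple_type.

(* The partial map ||-||; [None] means undefined. *)
Fixpoint erase (T : theory) (A : term (@arity T)) : option simple_type :=
  match A with
  | TYPE => Some Star
  | Con c _ => if type_level c then Some Star else None
  | Prod A B =>
      match erase A, erase B with
      | Some a, Some b => Some (Arrow a b)
      | _, _ => None
      end
  | App A _ => erase A
  | Lam _ B => erase B
  | Var _ | KIND => None
  end.

(* Main.v *)
Require Import Defs.
From mathcomp Require Import all_boot.
From Stdlib Require Import Relations.

Set Implicit Arguments.
Unset Strict Implicit.
Unset Printing Implicit Defensive.

(* The erasure never looks at a variable on which it is defined, so it is
   stable under arbitrary substitutions; this settles beta steps, and arity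
   preservation forces both sides of a type-level rule to erase to [Star].
   Conversion then follows by the Church-Rosser property. *)

Section Erasure.
Variable T : theory.
Local Notation term := (term (@arity T)).

(** Stated for every [s] because the induction passes from [s] to [up s] under a binder; this form
    also serves [subst], [subst_body] and instances of rules. *)
Lemma erase_inst (A : term) s a : erase A = Some a -> erase (inst s A) = Some a.
Proof.
elim/term_nested_ind: A s a => //=; first by move=> A M _ IM s a; apply: IM.
move=> A B IA IB s a.
case EA: (erase A) => [b|//]; case EB: (erase B) => [c|//].
by rewrite (IA s _ EA) (IB (up s) _ EB).
Qed.

Lemma erase_type_level_rhs (M : term) :
  type_level_rhs M -> erase M = Some Star.
Proof. by elim=> //= c args ->. Qed.

Lemma erase_step (A A' : term) a : arity_preserving T ->
  step A A' -> erase A = Some a -> erase A' = Some a.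
Proof.
(* Steps inside constant arguments, application arguments or [Lam] domains are invisible to [erase];
   those in a function or a [Lam] body are the induction hypothesis. *)
move=> harity stA; elim: stA a => //=.
- by move=> _ M N a; apply: erase_inst.
- move=> r s rP a; case: ifP => // tl [<-].
  exact/erase_inst/erase_type_level_rhs/harity.
- move=> A1 A2 B _ IA a; case EA: (erase A1) => [b|//].
  by rewrite (IA _ EA).
- move=> A1 B1 B2 _ IB a; case: (erase A1) => [b|//].
  by case EB: (erase B1) => [c|//]; rewrite (IB _ EB).
Qed.

Lemma erase_steps (A A' : term) a : arity_preserving T ->
  steps A A' -> erase A = Some a -> erase A' = Some a.
Proof.
move=> harity; elim=> // [M N|M N P _ IMN _ INP]; first exact: erase_step.
by move/IMN/INP.
Qed.

Lemma church_rosser (A B : term) : confluent T -> conv A B ->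
  exists Q, steps A Q /\ steps B Q.
Proof.
move=> hconf; elim=> [M N st|M|M N _ [Q []]|M N P _ [Q [MQ NQ]] _ [R [NR PR]]].
- by exists N; split; [apply: rt_step | apply: rt_refl].
- by exists M; split; apply: rt_refl.
- by exists Q.
(* Both [Q] and [R] are reducts of the middle term [N]. *)
- have [S [QS RS]] := hconf _ _ _ NQ NR.
  by exists S; split; [apply: rt_trans QS | apply: rt_trans RS].
Qed.

End Erasure.

Theorem mainTheorem8 (T : theory) (hconf : confluent T)
    (harity : arity_preserving T) :
  [/\ forall (A : term (@arity T)) (x : nat), isSome (erase A) ->
        forall N : term (@arity T),
        isSome (erase (subst A x N)) /\ erase A = erase (subst A x N),
      forall A A' : term (@arity T), step A A' -> isSome (erase A) ->
        isSome (erase A') /\ erase A = erase A'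
    & forall A A' : term (@arity T), conv A A' ->
        isSome (erase A) -> isSome (erase A') -> erase A = erase A'].
Proof.
split.
- move=> A x; case EA: (erase A) => [a|//] _ N.
  by rewrite /subst (erase_inst _ EA).
- move=> A A' st; case EA: (erase A) => [a|//] _.
  by rewrite (erase_step harity st EA).
(* An induction along [conv] would fail, since a backward step can make [erase] undefined:
   [App (Lam A (Var 0)) TYPE] reduces to [TYPE]. Forward reductions to a common reduct avoid
   this. *)
- move=> A A' /(church_rosser hconf)[Q [AQ A'Q]].
  case EA: (erase A) => [a|//]; case EA': (erase A') => [a'|//] _ _.
  by rewrite -(erase_steps harity AQ EA) (erase_steps harity A'Q EA').
Qed.
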